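(* Let $G=(V,E)$ be a hypergraph and consider a recursive McCormick relaxation (RMC) for the multilinear set $\mathcal{S}_G$. Then $\mathrm{MP}^{\mathrm{RMC}}_G=\mathrm{MP}^{\mathrm{LP}}_G$ if and only if the RMC is non-overlapping.
   Context: A hypergraph $G=(V,E)$ consists of a finite set $V$ of nodes and a set $E$ of subsets of $V$ of cardinality at least two, called edges. The rank of $G$ is $r=\max\{|e| : e\in E\}$. Throughout, $r\ge 3$ and every node belongs to at least one edge. The multilinear set of $G$ is $$\mathcal{S}_G=\Big\{z\in\{0,1\}^{V+E} : z_e=\prod_{v\in e} z_v,\ \forall e\in E\Big\}.$$ Standard linearization: $\mathrm{MP}^{\mathrm{LP}}_G$ is the set of $z\in\mathbb{R}^{V+E}$ such that $z_v\le 1$ for all $v\in V$; and $z_e\ge 0$, $z_e\ge\sum_{v\in e}z_v-|e|+1$ for all $e\in E$; and $z_e\le z_v$ for all $v\in e$ and all $e\in E$. Recursive McCormick relaxation (RMC). An RMC of $\mathcal{S}_G$ is obtained by recursively decomposing each multilinear term into bilinear ones. It is specified by a set $\bar E$ of subsets of $V$ of cardinality at least two with $E\cap\bar E=\emptyset$ (the artificial edges, each $e\in\bar E$ having an artificial variable $z_e$), and, for each $L\in E\cup\bar E$, one chosen partition $P_L=\{J,K\}$ of $L$ into two nonempty sets ($J\cup K=L$, $J\cap K=\emptyset$); the same partition $P_L$ is used wherever $L$ is decomposed. For each $e\in E$, the recursive sequence $\mathcal{R}_e$ is the smallest family of sets such that $e\in\mathcal{R}_e$ and, whenever $L\in\mathcal{R}_e$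 with $L\in\{e\}\cup\bar E$ and $P_L=\{J,K\}$, each of $J,K$ that has cardinality greater than one also belongs to $\mathcal{R}_e$ (so an edge $L \in E$ with $L\neq e$ that appears in $\mathcal{R}_e$ is not decomposed further within $\mathcal{R}_e$). The set $\bar E$ consists exactly of the sets that occur in $\bigcup_{e\in E}\mathcal{R}_e$ and are not in $E$. Writing $z_{\{v\}}:=z_v$ for $v\in V$, the RMC is the polyhedron in the variables $z_p$, $p\in V\cup E\cup\bar E$, defined by the inequalities $$z_{L}\ge 0,\quad z_{L}\ge z_J+z_K-1,\quad z_{L}\le z_J,\quad z_{L}\le z_K,\qquad \forall L\in E\cup\bar E,\ P_L=\{J,K\}.$$ $\mathrm{MP}^{\mathrm{RMC}}_G$ denotes the projection of the RMC onto the space of the original variables $z_p$, $p\in V\cup E$. An RMC with recursive sequences $\mathcal{R}_e$, $e\in E$, is non-overlapping if $\mathcal{R}_e\cap\mathcal{R}_{e'}=\emptyset$ for all $e\ne e'\in E$. *)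

(* Defs.v *)
From mathcomp Require Import boolp classical_sets.
From mathcomp Require Import all_boot all_order all_algebra.

Set Implicit Arguments.
Unset Strict Implicit.
Unset Printing Implicit Defensive.

Import Order.TTheory GRing.Theory Num.Theory.
Local Open Scope ring_scope.

Record hypergraph (V : finType) := Hypergraph {
  edges : {set {set V}};
  edges_card : forall e, e \in edges -> (1 < #|e|)%N
}.

Definition rank (V : finType) (G : hypergraph V) : nat :=
  \max_(e in edges G) #|e|.

(* The recursive sequence of e, for artificial edges A and decompositions P;
   a member of E other than e is a leaf, since E is disjoint from A in an RMC. *)
Inductive recseq (V : finType) (A : {set {set V}})
    (P : {set V} -> {set {set V}}) (e : {set V}) : set {set V} :=
| recseq_root : recseq A P e e
| recseq_step (L J : {set V}) :
    recseq A P e L -> L = e \/ L \in A -> J \in P L -> (1 < #|J|)%N ->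
    recseq A P e J.

(* The total function [part] is only meaningful on [edges G :|: aedges]. *)
Record RMC (V : finType) (G : hypergraph V) := MkRMC {
  aedges : {set {set V}};
  part : {set V} -> {set {set V}};
  aedges_card : forall L, L \in aedges -> (1 < #|L|)%N;
  aedges_disjoint : [disjoint edges G & aedges];
  partP : forall L, L \in edges G :|: aedges ->
    finset.partition (part L) L /\ #|part L| = 2%N;
  aedgesP : forall L, L \in aedges <->
    L \notin edges G /\ exists2 e, e \in edges G & recseq aedges part e L
}.

Definition rseq (V : finType) (G : hypergraph V) (M : RMC G) (e : {set V}) :
  set {set V} := recseq (aedges M) (part M) e.

Definition non_overlapping (V : finType) (G : hypergraph V) (M : RMC G) : Prop :=
  forall e e', e \in edges G -> e' \in edges G -> e != e' ->
    (rseq M e `&` rseq M e' = classical_sets.set0)%classic.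

Definition ovar (V : finType) (G : hypergraph V) : finType :=
  (V + {e : {set V} | e \in edges G})%type.

Definition rvar (V : finType) (G : hypergraph V) (M : RMC G) : finType :=
  (ovar G + {L : {set V} | L \in aedges M})%type.

Definition MP_LP (R : realFieldType) (V : finType) (G : hypergraph V) :
    set {ffun ovar G -> R} := fun z =>
  (forall v : V, z (inl v) <= 1) /\
  (forall e : {e : {set V} | e \in edges G},
    [/\ 0 <= z (inr e),
        \sum_(v in val e) z (inl v) - #|val e|%:R + 1 <= z (inr e)
      & forall v, v \in val e -> z (inr e) <= z (inl v)]).

(* The coordinate z_J, with z_{v} read as z_v. The default 0 is never reached
   for J in E, in Ebar, or in the partition of a member of these. *)
Definition zcoord (R : realFieldType) (V : finType) (G : hypergraph V)
    (M : RMC G) (z : {ffun rvar M -> R}) (J : {set V}) : R :=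
  if [pick v | J == [set v]] is Some v then z (inl (inl v))
  else if insub J is Some e then z (inl (inr e))
  else if insub J is Some L then z (inr L)
  else 0.

Definition RMC_polyhedron (R : realFieldType) (V : finType)
    (G : hypergraph V) (M : RMC G) : set {ffun rvar M -> R} := fun z =>
  forall L J K, L \in edges G :|: aedges M -> part M L = [set J; K] ->
    [/\ 0 <= zcoord z L,
        zcoord z J + zcoord z K - 1 <= zcoord z L,
        zcoord z L <= zcoord z J
      & zcoord z L <= zcoord z K].

Definition MP_RMC (R : realFieldType) (V : finType) (G : hypergraph V)
    (M : RMC G) : set {ffun ovar G -> R} :=
  ((fun z : {ffun rvar M -> R} => [ffun p => z (inl p)])
     @` @RMC_polyhedron R V G M)%classic.

Arguments MP_LP R {V} G.
Arguments MP_RMC R {V G} M.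

(* Main.v *)
Require Import Defs.
From mathcomp Require Import boolp classical_sets.
From mathcomp Require Import all_boot all_order all_algebra.
From mathcomp Require Import lra.

Set Implicit Arguments.
Unset Strict Implicit.
Unset Printing Implicit Defensive.

Import Order.TTheory GRing.Theory Num.Theory.
Local Open Scope ring_scope.

(** The proof measures everything by the deficit d(S), the sum of 1 - z_v over
    the nodes v of S, so that the lower bound of the standard linearization
    reads z_e >= 1 - d(e).

    Chaining the McCormick inequalities along the decomposition of L gives
    z_L <= z_v for v in L, z_L >= 1 - d(L), and z_v <= 1
    ([zcoord_le_node], [zcoord_ge_deficit], [zcoord_node_le1]).  Hence the
    projection of any RMC is contained in the standard linearization
    ([MP_RMC_sub_MP_LP]), and only the converse inclusion matters.

    If the RMC is non-overlapping, every artificial edge L belongs to R_e for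
    exactly one edge e, and a point z of the standard linearization is lifted
    by z_L := max(z_e, 1 - d(L)).  The same formula holds at e itself and at the
    nodes of e, and it satisfies the McCormick inequalities because d is
    additive and nonnegative and z_e is between 0 and 1
    ([lift_in_RMC_polyhedron]).

    If L lies in both R_e and R_e' with e != e', every point of the RMC
    satisfies z_e <= z_L ([zcoord_root_le]) and
    z_e' >= z_L - (d(e') - d(L)) ([zcoord_root_ge]).  The point with z_v = 1/2
    on L and z_v = 1 elsewhere, z_e = 1/2, and every other edge variable at its
    smallest feasible value is in the standard linearization.  There
    d(e') = d(L) >= 1, so z_e' = 0 although the RMC forces z_e' >= z_e = 1/2
    ([overlap_point_in_MP_LP], [overlap_point_notin_MP_RMC]). *)

(** * Decompositions in a recursive McCormick relaxation *)

Section Decomposition.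
Variables (V : finType) (G : hypergraph V) (M : RMC G).
Implicit Types (L J K e : {set V}).

(** The sets that carry a variable: the edges, original or artificial, and the
    singletons, which stand for the nodes. *)
Definition factor L : Prop :=
  (exists v, L = [set v]) \/ L \in edges G :|: aedges M.

Lemma rseq_term e L : e \in edges G -> rseq M e L ->
  L \in edges G :|: aedges M.
Proof.
move=> eG eL; rewrite inE; case: (boolP (L \in edges G)) => //= LnG.
by apply/aedgesP; split=> //; exists e.
Qed.

Lemma term_card L : L \in edges G :|: aedges M -> (1 < #|L|)%N.
Proof. by rewrite inE => /orP[/edges_card|/aedges_card]. Qed.

Lemma part_pair L J : L \in edges G :|: aedges M -> J \in part M L ->
  exists K, [/\ part M L = [set J; K], J :|: K = L & [disjoint J & K]].
Proof.
move=> LT JP; have [Lpart /eqP/cards2P[A [B [AB PE]]]] := partP LT.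
have /and3P[/eqP Lcov /trivIsetP Ltriv _] := Lpart.
have disjAB : [disjoint A & B].
  by apply: Ltriv; rewrite ?PE ?inE ?eqxx ?orbT.
have ABL : A :|: B = L by rewrite -Lcov PE /cover bigcup_setU !big_set1.
move: JP; rewrite PE !inE => /orP[]/eqP->; first by exists B.
by exists A; rewrite setUC setUC [B :|: A]setUC disjoint_sym.
Qed.

Lemma part_proper L J : L \in edges G :|: aedges M -> J \in part M L ->
  (0 < #|J|)%N /\ (#|J| < #|L|)%N.
Proof.
move=> LT JP; have [K [PE JKL dJK]] := part_pair LT JP.
have [/and3P[_ _ P0] _] := partP LT.
have KP : K \in part M L by rewrite PE !inE eqxx orbT.
have pos S : S \in part M L -> (0 < #|S|)%N.
  by move=> SP; rewrite lt0n cards_eq0; apply: contraNneq P0 => <-.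
split; first exact: pos.
rewrite -JKL cardsU; move: dJK; rewrite -setI_eq0 => /eqP->.
by rewrite cards0 subn0 -addn1 leq_add2l pos.
Qed.

(** A block of a decomposed set is a node or again a decomposed set: the tree
    below L never stops before the nodes.  If L is an edge, its block is found in
    R_L, and otherwise in a sequence R_e that contains the artificial edge L. *)
Lemma part_factor L J : L \in edges G :|: aedges M -> J \in part M L ->
  factor J.
Proof.
move=> LT JP; have [J0 _] := part_proper LT JP.
have [J1|J1] := leqP #|J| 1.
  by left; apply/cards1P; rewrite eqn_leq J1.
right; move: (LT); rewrite inE => /orP[LG|LA].
  apply: (rseq_term LG); apply: (recseq_step (L := L)) => //.
    exact: recseq_root.
  by left.
have [_ [e eG eL]] := (aedgesP M L).1 LA.
by apply: (rseq_term eG); apply: (recseq_step eL) => //; right.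
Qed.

(** Induction along the decompositions, from the nodes up to L. *)
Lemma factor_ind (Q : {set V} -> Prop) :
  (forall v, Q [set v]) ->
  (forall L J K, L \in edges G :|: aedges M -> part M L = [set J; K] ->
     J :|: K = L -> [disjoint J & K] -> Q J -> Q K -> Q L) ->
  forall L, factor L -> Q L.
Proof.
move=> Q1 QS L; move: {2}#|L| (leqnn #|L|) => n.
elim: n L => [|n IHn] L Ln [[v ->]//|LT].
  by have := term_card LT; rewrite ltnNge (leq_trans Ln).
have [_ /eqP/cards2P[J [K0 [_ PE0]]]] := partP LT.
have JP : J \in part M L by rewrite PE0 !inE eqxx.
have [K [PE JKL dJK]] := part_pair LT JP.
have KP : K \in part M L by rewrite PE !inE eqxx orbT.
have QP S : S \in part M L -> Q S.
  move=> SP; apply: IHn; last exact: part_factor SP.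
  by have [_ SL] := part_proper LT SP; rewrite -ltnS (leq_trans SL).
by apply: QS PE JKL dJK _ _ => //; apply: QP.
Qed.

Lemma rseq_sub e L : e \in edges G -> rseq M e L -> L \subset e.
Proof.
move=> eG; elim=> [|S J eS IH Sdec JP _]; first exact: subxx.
have [K [_ JKS _]] := part_pair (rseq_term eG eS) JP.
by apply: subset_trans IH; rewrite -JKS subsetUl.
Qed.

Lemma rseq_card e L : e \in edges G -> rseq M e L -> (1 < #|L|)%N.
Proof. by move=> eG /(rseq_term eG)/term_card. Qed.

Lemma non_overlapping_root e e' L : non_overlapping M ->
  e \in edges G -> e' \in edges G -> rseq M e L -> rseq M e' L -> e = e'.
Proof.
move=> NO eG e'G eL e'L; apply/eqP; apply: contrapT => /negP ee'.
by have /seteqP[/(_ L (conj eL e'L))] := NO e e' eG e'G ee'.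
Qed.

End Decomposition.

(** * Deficits and the standard linearization *)

Section Deficit.
Variables (R : realFieldType) (V : finType) (G : hypergraph V).
Implicit Types (z : {ffun ovar G -> R}) (S T : {set V}).

(** The deficit d(S): how far the node values on S fall short of 1 in total. *)
Definition deficit z S : R := \sum_(v in S) (1 - z (inl v)).

Lemma deficit1 z v : deficit z [set v] = 1 - z (inl v).
Proof. by rewrite /deficit big_set1. Qed.

Lemma deficitU z S T : [disjoint S & T] ->
  deficit z (S :|: T) = deficit z S + deficit z T.
Proof.
by move=> dST; rewrite /deficit -bigU //; apply: eq_bigl => v; rewrite !inE.
Qed.

Lemma deficit_ge0 z S : (forall v, z (inl v) <= 1) -> 0 <= deficit z S.
Proof. by move=> z1; apply: sumr_ge0 => v _; rewrite subr_ge0. Qed.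

Lemma deficit_ge_node z S v : (forall v, z (inl v) <= 1) -> v \in S ->
  1 - z (inl v) <= deficit z S.
Proof.
move=> z1 vS; rewrite /deficit (bigD1 v) //= lerDl.
by apply: sumr_ge0 => w _; rewrite subr_ge0.
Qed.

Lemma deficitE z S :
  \sum_(v in S) z (inl v) - #|S|%:R + 1 = 1 - deficit z S.
Proof. by rewrite /deficit sumrB sumr_const; lra. Qed.

End Deficit.

(** * The inequalities implied by the relaxation *)

Section Zcoord.
Variables (R : realFieldType) (V : finType) (G : hypergraph V) (M : RMC G).
Variable z : {ffun rvar M -> R}.
Implicit Types (L e : {set V}).

Lemma zcoord_node v : zcoord z [set v] = z (inl (inl v)).
Proof.
rewrite /zcoord; case: pickP => [w /eqP/set1_inj -> //|/(_ v)].
by rewrite eqxx.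
Qed.

Lemma zcoord_nonode L : (1 < #|L|)%N ->
  zcoord z L = if insub L is Some e then z (inl (inr e))
               else if insub L is Some A then z (inr A) else 0.
Proof.
move=> L1; rewrite /zcoord; case: pickP => [w /eqP Lw|//].
by move: L1; rewrite Lw cards1.
Qed.

Lemma zcoord_edge (e : {e : {set V} | e \in edges G}) :
  zcoord z (val e) = z (inl (inr e)).
Proof. by rewrite zcoord_nonode ?valK //; apply: edges_card (valP e). Qed.

Lemma zcoord_aedge (L : {L : {set V} | L \in aedges M}) :
  zcoord z (val L) = z (inr L).
Proof.
rewrite zcoord_nonode; last exact: aedges_card (valP L).
by rewrite insubN ?valK // (disjointFl (aedges_disjoint M) (valP L)).
Qed.

Hypothesis zP : RMC_polyhedron z.

Local Notation d := (deficit [ffun p => z (inl p)]).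

Lemma zcoord_le_node L v : factor M L -> v \in L ->
  zcoord z L <= z (inl (inl v)).
Proof.
move=> LF; move: L LF v; apply: factor_ind => [w v|L J K LT PE JKL _ IJ IK v].
  by rewrite inE => /eqP->; rewrite zcoord_node.
have [_ _ LJ LK] := zP LT PE.
by rewrite -{1}JKL inE => /orP[/IJ|/IK]; apply: le_trans.
Qed.

Lemma zcoord_ge_deficit L : factor M L -> 1 - d L <= zcoord z L.
Proof.
move: L; apply: factor_ind => [v|L J K LT PE JKL dJK IJ IK].
  by rewrite deficit1 zcoord_node ffunE; lra.
have [_ LJK _ _] := zP LT PE.
by rewrite -JKL deficitU // JKL; lra.
Qed.

(** From z_J + z_K - 1 <= z_L <= z_K one gets z_J <= 1, which bounds each node
    split off as a singleton. *)
Lemma zcoord_node_le1 L v : L \in edges G :|: aedges M -> v \in L ->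
  z (inl (inl v)) <= 1.
Proof.
move=> LT vL.
suff /(_ L (or_intror LT) v vL)[LE|//] : forall S, factor M S ->
    forall v, v \in S -> S = [set v] \/ z (inl (inl v)) <= 1.
  by have := term_card LT; rewrite LE cards1.
apply: factor_ind => {LT vL L v} [w v|L J K LT PE JKL _ IJ IK v].
  by rewrite inE => /eqP->; left.
have [_ LJK LJ LK] := zP LT PE.
rewrite -{1}JKL inE => /orP[/IJ|/IK] [E|]; right => //;
  rewrite -zcoord_node -E; lra.
Qed.

Lemma zcoord_root_le e L : e \in edges G -> rseq M e L ->
  zcoord z e <= zcoord z L.
Proof.
move=> eG; elim=> [|S J eS IH _ JP _]; first exact: lexx.
have ST := rseq_term eG eS; have [K [PE _ _]] := part_pair ST JP.
by have [_ _ SJ _] := zP ST PE; apply: le_trans SJ.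
Qed.

(** The value of z_L is passed up to the root e, losing at most the deficit of
    the nodes of e outside L. *)
Lemma zcoord_root_ge e L : e \in edges G -> rseq M e L ->
  zcoord z L - (d e - d L) <= zcoord z e.
Proof.
move=> eG; elim=> [|S J eS IH _ JP _]; first lra.
have ST := rseq_term eG eS; have [K [PE JKS dJK]] := part_pair ST JP.
have [_ SJK _ _] := zP ST PE.
have KF : factor M K by apply: (part_factor ST); rewrite PE !inE eqxx orbT.
have := zcoord_ge_deficit KF.
by move: IH; rewrite -{2}JKS deficitU //; lra.
Qed.

End Zcoord.

Lemma MP_RMC_sub_MP_LP (R : realFieldType) (V : finType) (G : hypergraph V)
    (hcover : forall v : V, exists2 e, e \in edges G & v \in e) (M : RMC G) :
  (MP_RMC R M `<=` MP_LP R G)%classic.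
Proof.
move=> _ [z zP <-]; split=> [v|e].
  have [e eG ve] := hcover v; rewrite ffunE.
  by apply: (zcoord_node_le1 zP _ ve); rewrite inE eG.
have eT : val e \in edges G :|: aedges M by rewrite inE (valP e).
have eF : factor M (val e) by right.
rewrite deficitE !ffunE -zcoord_edge; split.
- have [_ /eqP/cards2P[J [K [_ PE]]]] := partP eT.
  by have [] := zP _ _ _ eT PE.
- exact: zcoord_ge_deficit.
- by move=> v ve; rewrite ffunE; apply: zcoord_le_node.
Qed.

(** * Lifting a point in the non-overlapping case *)

Section Lift.
Variables (R : realFieldType) (V : finType) (G : hypergraph V) (M : RMC G).
Variable z : {ffun ovar G -> R}.
Hypotheses (zLP : MP_LP R G z) (NO : non_overlapping M).

(** The extension of z by z_L := max(z_e, 1 - d(L)), where e is an edge with L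
    in R_e.  Such an edge exists for every artificial L, so the default 0 is
    never used. *)
Definition lift_point : {ffun rvar M -> R} := [ffun p : rvar M =>
  match p return R with
  | inl q => z q
  | inr L =>
      if [pick e : {e | e \in edges G} | `[< rseq M (val e) (val L) >]]
        is Some e
      then Num.max (z (inr e)) (1 - deficit z (val L)) else 0
  end].

(** At a node the maximum is z_v itself, since z_e <= z_v for v in e. *)
Lemma lift_point_node (e : {e | e \in edges G}) v : v \in val e ->
  zcoord lift_point [set v] =
    Num.max (z (inr e)) (1 - deficit z [set v]).
Proof.
move=> ve; have [_ _ /(_ v ve) zev] := zLP.2 e.
by rewrite zcoord_node ffunE deficit1 subKr; apply/esym/max_idPr.
Qed.

Lemma lift_point_rseq (e : {e | e \in edges G}) L : rseq M (val e) L ->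
  zcoord lift_point L = Num.max (z (inr e)) (1 - deficit z L).
Proof.
move=> eL; have [_ lo _] := zLP.2 e.
case: (boolP (L \in edges G)) => [LG|LnG].
  (* L is also the root of its own sequence R_L, which is disjoint from R_e
     unless L = e. *)
  have Le : L = val e.
    apply: (non_overlapping_root NO LG (valP e) _ eL); exact: recseq_root.
  by rewrite Le zcoord_edge ffunE -deficitE; apply/esym/max_idPl.
have LA : L \in aedges M.
  by apply/aedgesP; split=> //; exists (val e) => //; apply: valP.
rewrite -[L]/(val (exist (fun L => L \in aedges M) L LA)) zcoord_aedge ffunE /=.
case: pickP => [e' /asboolP e'L|/(_ e)/asboolP//].
by rewrite (val_inj (non_overlapping_root NO (valP e') (valP e) e'L eL)).
Qed.

Lemma lift_in_RMC_polyhedron : RMC_polyhedron lift_point.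
Proof.
move=> L J K LT PE.
have [e [eL Ldec]] : exists e : {e | e \in edges G},
    rseq M (val e) L /\ (L = val e \/ L \in aedges M).
  move: (LT); rewrite inE => /orP[LG|LA].
    by exists (exist _ L LG); split; [exact: recseq_root | left].
  have [_ [e eG eL]] := (aedgesP M L).1 LA.
  by exists (exist _ e eG); split=> //; right.
have Le := rseq_sub (valP e) eL.
have partE S : S \in part M L ->
    zcoord lift_point S = Num.max (z (inr e)) (1 - deficit z S).
  move=> SP; have [S0 _] := part_proper LT SP.
  have [S1|S1] := leqP #|S| 1; last first.
    by apply: lift_point_rseq; apply: (recseq_step eL).
  have /cards1P[v Sv] : #|S| == 1%N by rewrite eqn_leq S1.
  rewrite Sv; apply: lift_point_node; apply: (subsetP Le).
  by have [T [_ <- _]] := part_pair LT SP; rewrite Sv !inE eqxx.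
have JP : J \in part M L by rewrite PE !inE eqxx.
have KP : K \in part M L by rewrite PE !inE eqxx orbT.
rewrite (lift_point_rseq eL) (partE J) // (partE K) //.
have dL : deficit z L = deficit z J + deficit z K.
  (* [part_pair] gives the block K' opposite to J, which is K as J != K. *)
  have [K' [PE' <- dJK']] := part_pair LT JP.
  have [_ P2] := partP LT.
  have K'K : K' = K.
    have JK : J != K by move: P2; rewrite PE cards2; case: eqP.
    by move: KP; rewrite PE' !inE eq_sym (negPf JK) /= => /eqP.
  by rewrite deficitU // K'K.
have z1 := zLP.1; have [e0 _ ev] := zLP.2 e.
have e1 : z (inr e) <= 1.
  have /card_gt0P[v ve] : (0 < #|val e|)%N by apply/ltnW/edges_card/valP.
  exact: le_trans (ev v ve) (z1 v).
have dJ := deficit_ge0 J z1; have dK := deficit_ge0 K z1.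
rewrite dL; split; rewrite !maxEle; repeat case: ifP => /=; lra.
Qed.

End Lift.

(** * Separating a point in the overlapping case *)

Section Overlap.
Variables (R : realFieldType) (V : finType) (G : hypergraph V).
Variables (e L : {set V}).

(** The value 1/2 at e and at the nodes of L, 1 at the other nodes, and the
    smallest value max(0, 1 - d(f)) permitted by the standard linearization at
    every other edge f, whose deficit is half the cardinality of f :&: L. *)
Definition overlap_point : {ffun ovar G -> R} := [ffun p : ovar G =>
  match p return R with
  | inl v => if v \in L then 2^-1 else 1
  | inr f => if val f == e then 2^-1
             else Num.max 0 (1 - #|val f :&: L|%:R / 2)
  end].

Lemma overlap_point_deficit S : deficit overlap_point S = #|S :&: L|%:R / 2.
Proof.
rewrite /deficit (big_setID L) /= [X in _ + X]big1 ?addr0; last first.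
  by move=> v; rewrite inE => /andP[/negPf vL _]; rewrite ffunE vL subrr.
rewrite (eq_bigr (fun=> 2^-1)) => [|v].
  by rewrite sumr_const -[_ *+ #|_|]mulr_natl.
by rewrite inE => /andP[_ vL]; rewrite ffunE vL; lra.
Qed.

Lemma overlap_point_in_MP_LP :
  (1 < #|L|)%N -> L \subset e -> MP_LP R G overlap_point.
Proof.
move=> L1 Le.
have v01 v : 2^-1 <= overlap_point (inl v) <= 1.
  by rewrite ffunE; case: ifP => _; apply/andP; split; lra.
have v1 v : overlap_point (inl v) <= 1 by case/andP: (v01 v).
split=> // f; rewrite deficitE [overlap_point (inr f)]ffunE.
case: eqP => [fe|_]; last first.
  rewrite overlap_point_deficit; split; rewrite ?le_max ?lexx ?orbT // => v vf.
  rewrite ge_max; apply/andP; split; first by case/andP: (v01 v); lra.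
  by rewrite -overlap_point_deficit; have := deficit_ge_node v1 vf; lra.
split=> [||v _]; last by case/andP: (v01 v).
  by lra.
have {}L1 : 2 <= #|L|%:R :> R by rewrite ler_nat.
by rewrite fe overlap_point_deficit (setIidPr Le); lra.
Qed.

Lemma overlap_point_notin_MP_RMC (M : RMC G) e' :
  e \in edges G -> e' \in edges G -> e != e' -> rseq M e L -> rseq M e' L ->
  ~ MP_RMC R M overlap_point.
Proof.
move=> eG e'G ee' eL e'L [z zP zE].
have eqz f (fG : f \in edges G) :
    zcoord z f = overlap_point (inr (exist _ f fG)).
  rewrite -[f in LHS]/(val (exist (fun f => f \in edges G) f fG)) zcoord_edge.
  by rewrite -zE ffunE.
have := zcoord_root_le zP eG eL; have := zcoord_root_ge zP e'G e'L.
rewrite zE !overlap_point_deficit setIid (setIidPr (rseq_sub e'G e'L)).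
rewrite (eqz _ eG) (eqz _ e'G) !ffunE /= eqxx eq_sym (negPf ee').
rewrite (setIidPr (rseq_sub e'G e'L)).
have : 2 <= #|L|%:R :> R by rewrite ler_nat; apply: rseq_card eL.
by rewrite maxEle; case: ifP => /=; lra.
Qed.

End Overlap.

Theorem proposition2 (R : realFieldType) (V : finType) (G : hypergraph V)
    (hrank : (3 <= rank G)%N)
    (hcover : forall v : V, exists2 e, e \in edges G & v \in e)
    (M : RMC G) :
  MP_RMC R M = MP_LP R G <-> non_overlapping M.
Proof.
split=> [RMC_LP e e' eG e'G ee'|NO].
  apply/seteqP; split=> // L [eL e'L].
  apply: (overlap_point_notin_MP_RMC (R := R) eG e'G ee' eL e'L).
  rewrite RMC_LP; apply: overlap_point_in_MP_LP.
    exact: rseq_card eL.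
  exact: rseq_sub eL.
apply/seteqP; split; first exact: MP_RMC_sub_MP_LP.
move=> z zLP; exists (lift_point M z); first exact: lift_in_RMC_polyhedron.
by apply/ffunP => p; rewrite !ffunE.
Qed.
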